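(* Let $A$ be a super-amenable Banach algebra and let $B$ be a Banach $A$-bimodule which factors on the left [resp. on the right]. Then there is a Banach $A$-bimodule $(C,\cdot)$, with $C=B$ as a Banach space, such that $$Z^1(A,C)=\{L_{D''(e'')}: D\in Z^1(A,C)\}\quad[\text{resp. } Z^1(A,C)=\{R_{D''(e'')}: D\in Z^1(A,C)\}],$$ where $e''$ is a right [resp. left] identity for $A^{**}$.
   Context: A derivation from $A$ into a Banach $A$-bimodule $E$ is a bounded linear map $D$ with $D(xy)=xD(y)+D(x)y$; $Z^1(A,E)$ is the space of all of them; $D$ is inner if $D(a)=ae-ea$ for some $e\in E$. $A$ is super-amenable if every derivation from $A$ into every Banach $A$-bimodule is inner. $B$ factors on the left if $BA=\{ba:b\in B,a\in A\}=B$, and on the right if $AB=B$. $D'':A^{**}\to C^{**}$ is the second adjoint of $D:A\to C$. $A^{**}$ carries the first Arens product: $\langle a'a,b\rangle=\langle a',ab\rangle$, $\langle a''a',a\rangle=\langle a'',a'a\rangle$, $\langle a''b'',a'\rangle=\langle a'',b''a'\rangle$. For an element $c$ of $C$ (or of $C^{**}$, with its bidual $A$-bimodule structure), $L_c(a)=c\cdot a$ and $R_c(a)=a\cdot c$ for $a\in A$; $C$ is identified with its canonical image in $C^{**}$. *)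

(* Defs.v *)
From HB Require Import structures.
From mathcomp Require Import all_boot all_order all_algebra.
From mathcomp Require Import all_classical all_reals all_analysis.
From mathcomp Require Import complex.

Set Implicit Arguments.
Unset Strict Implicit.
Unset Printing Implicit Defensive.

Import Order.TTheory GRing.Theory Num.Theory.
Import numFieldNormedType.Exports.

Local Open Scope classical_set_scope.
Local Open Scope ring_scope.

(* Norms of [normedModType K] take their values in [K] itself, so the operator
   norm, an infimum, only makes sense if [K] has infima of nonempty sets of
   nonnegative elements. This leaves exactly the real and the complex numbers;
   both are shown to be instances below. *)
HB.mixin Record NumField_hasNonnegInf K of Num.NumField K := {
  nonneg_infimums : forall S : set K,
    S !=set0 -> lbound S 0 -> infimums S !=set0 }.

#[short(type="scalarFieldType")]
HB.structure Definition ScalarField :=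
  {K of Num.NumField K & NumField_hasNonnegInf K}.

Lemma real_nonneg_infimums (R : realType) (S : set R) :
  S !=set0 -> lbound S 0 -> infimums S !=set0.
Proof.
move=> S0 lS; have hS : has_inf S by split=> //; exists 0.
exists (inf S); split; first by move=> x Sx; apply: ge_inf => //; exists 0.
by move=> l lSl; apply: lb_le_inf.
Qed.

#[non_forgetful_inheritance]
HB.instance Definition _ (R : realType) :=
  NumField_hasNonnegInf.Build R (@real_nonneg_infimums R).

Lemma complex_nonneg_infimums (R : realType) (S : set R[i]) :
  S !=set0 -> lbound S 0 -> infimums S !=set0.
Proof.
move=> [s Ss] lS; pose T := [set x : R | S x%:C%C].
have SE z : S z -> z = (complex.Re z)%:C%C.
  by move=> /lS; rewrite lecE /= => /andP[/eqP + _]; case: z => a b /= ->.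
have [m [mT Tm]] : infimums T !=set0.
  apply: real_nonneg_infimums; first by exists (complex.Re s); rewrite /T /= -SE.
  by move=> x /lS; rewrite lecE /= => /andP[].
exists m%:C%C; split=> [z Sz | l lSl].
  by rewrite (SE _ Sz) lecR; apply: mT; rewrite /T /= -SE.
have := lSl _ Ss; rewrite (SE _ Ss) !lecE /= => /andP[/eqP l0 _].
rewrite -l0 eqxx /=; apply: Tm => x Tx.
by have := lSl _ Tx; rewrite lecE /= => /andP[].
Qed.

#[non_forgetful_inheritance]
HB.instance Definition _ (R : realType) :=
  NumField_hasNonnegInf.Build R[i] (@complex_nonneg_infimums R).

Section BoundedLinearMaps.
Context {K : scalarFieldType} {E F : normedModType K}.
Implicit Types (f : E -> F).

Definition bounds f : set K :=
  [set M | 0 <= M /\ forall x, `|f x| <= M * `|x|].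

Definition bounded_linear : {pred E -> F} :=
  mem [set f | linear f /\ bounds f !=set0].

Definition opnorm f : K := infimum 0 (bounds f).

Lemma bounded_linear_submod : submod_closed bounded_linear.
Proof.
split=> [|a f g].
  rewrite inE; split=> [c x y | ]; first by rewrite scaler0 addr0.
  by exists 0; split=> // x; rewrite normr0 mul0r.
rewrite !inE => -[lf [M [M0 hM]]] [lg [N [N0 hN]]]; split=> [c x y | ].
  rewrite !fctE lf lg !scalerDr !scalerA (mulrC a c) !addrA; congr (_ + _).
  by rewrite -!addrA; congr (_ + _); rewrite addrC.
exists (`|a| * M + N); split=> [|x]; first by rewrite addr_ge0 ?mulr_ge0.
rewrite !fctE mulrDl (le_trans (ler_normD _ _)) // lerD // normrZ -mulrA.
by rewrite ler_wpM2l.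
Qed.

HB.instance Definition _ :=
  GRing.isSubmodClosed.Build K (E -> F) bounded_linear bounded_linear_submod.

End BoundedLinearMaps.

Section Blin.
Context {K : scalarFieldType}.
Variables (E F : normedModType K).

Record blin := Blin {
  blin_fun :> E -> F;
  blinP : blin_fun \in bounded_linear }.

HB.instance Definition _ := [isSub for blin_fun].
HB.instance Definition _ := [Choice of blin by <:].
HB.instance Definition _ := [SubChoice_isSubLmodule of blin by <:].

Implicit Types f g : blin.

Lemma blin_linear f : linear f.
Proof. by have := blinP f; rewrite inE => -[]. Qed.

Lemma blin_bounds f : bounds f !=set0.
Proof. by have := blinP f; rewrite inE => -[]. Qed.

Lemma opnorm_infimums f : infimums (bounds f) (opnorm f).
Proof.
rewrite /opnorm /infimum; case: ifPn => [/eqP f0|_].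
  by have := blin_bounds f; rewrite f0 => /set0P; rewrite eqxx.
case: xgetP => [m _ //|none].
have [m fm] : infimums (bounds f) !=set0.
  by apply: nonneg_infimums; [exact: blin_bounds | move=> x []].
by case: (none m).
Qed.

Lemma opnorm_ge0 f : 0 <= opnorm f.
Proof. by have [_] := opnorm_infimums f; apply=> x []. Qed.

Lemma opnorm_le f M : 0 <= M -> (forall x, `|f x| <= M * `|x|) -> opnorm f <= M.
Proof. by move=> M0 hM; have [+ _] := opnorm_infimums f; apply. Qed.

Lemma blinZD f (a : K) x y : f (a *: x + y) = a *: f x + f y.
Proof. exact: blin_linear. Qed.

Lemma blin0 f : f 0 = 0.
Proof. by have := blinZD f (-1) 0 0; rewrite scaler0 add0r scaleN1r addNr. Qed.

Lemma le_opnorm f x : `|f x| <= opnorm f * `|x|.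
Proof.
have [->|x0] := eqVneq x 0; first by rewrite blin0 !normr0 mulr0.
have xgt0 : 0 < `|x| by rewrite normr_gt0.
rewrite -ler_pdivrMr //; have [_] := opnorm_infimums f; apply=> M [_ hM].
by rewrite ler_pdivrMr.
Qed.

Lemma blin_ext f g : f =1 g -> f = g.
Proof. by move=> fg; apply: val_inj; apply: funext. Qed.

Lemma opnormD f g : opnorm (f + g) <= opnorm f + opnorm g.
Proof.
apply: opnorm_le => [|x]; first by rewrite addr_ge0 ?opnorm_ge0.
rewrite mulrDl (le_trans (ler_normD (f x) (g x))) // lerD //; exact: le_opnorm.
Qed.

Lemma opnormZ_le (a : K) f : opnorm (a *: f) <= `|a| * opnorm f.
Proof.
apply: opnorm_le => [|x]; first by rewrite mulr_ge0 ?opnorm_ge0.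
rewrite -mulrA (_ : blin_fun _ x = a *: f x) // normrZ.
by rewrite ler_wpM2l //; exact: le_opnorm.
Qed.

Lemma opnormZ (a : K) f : opnorm (a *: f) = `|a| * opnorm f.
Proof.
apply/eqP; rewrite eq_le opnormZ_le andTb.
have [->|a0] := eqVneq a 0; first by rewrite normr0 mul0r opnorm_ge0.
rewrite -ler_pdivlMl ?normr_gt0 // -normfV.
by rewrite -{1}(scalerK a0 f) opnormZ_le.
Qed.

Lemma opnorm_eq0 f : opnorm f = 0 -> f = 0.
Proof.
move=> f0; apply: blin_ext => x; have := le_opnorm f x.
by rewrite f0 mul0r normr_le0 => /eqP.
Qed.

HB.instance Definition _ :=
  Lmodule_isNormed.Build K blin opnormD opnormZ opnorm_eq0.

Lemma blin_normE f : `|f| = opnorm f.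
Proof. by []. Qed.

Lemma le_blin_norm f x : `|f x| <= `|f| * `|x|.
Proof. exact: le_opnorm. Qed.

Lemma mk_blin_subproof (f : E -> F) : linear f ->
  (exists M, forall x, `|f x| <= M * `|x|) -> f \in bounded_linear.
Proof.
move=> lf [M hM]; rewrite inE; split=> //; exists `|M|; split=> // x.
rewrite (le_trans (hM x)) //.
have Mx : 0 <= M * `|x| by apply: le_trans (hM x).
by rewrite -(ger0_norm Mx) normrM normr_id.
Qed.

Definition mk_blin (f : E -> F) (lf : linear f)
  (bf : exists M, forall x, `|f x| <= M * `|x|) : blin :=
  Blin (mk_blin_subproof lf bf).

End Blin.

Section Duality.
Context {K : scalarFieldType}.
Implicit Types E F : normedModType K.

Definition dual E := blin E K^o.
HB.instance Definition _ E := NormedModule.on (dual E).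

Lemma bidual_emb_linear E (x : E) : linear (fun f : dual E => f x : K^o).
Proof. by []. Qed.

Lemma bidual_emb_bounded E (x : E) :
  exists M, forall f : dual E, `|f x| <= M * `|f|.
Proof. by exists `|x| => f; rewrite mulrC; exact: le_blin_norm. Qed.

Definition bidual_emb E (x : E) : dual (dual E) :=
  mk_blin (bidual_emb_linear x) (bidual_emb_bounded x).

Section Adjoint.
Variables (E F : normedModType K) (T : blin E F).

Lemma comp_linear (f : dual F) : linear (fun x => f (T x)).
Proof. by move=> a x y; rewrite !blinZD. Qed.

Lemma comp_le (f : dual F) x : `|f (T x)| <= (`|f| * `|T|) * `|x|.
Proof.
rewrite (le_trans (le_blin_norm _ _)) // -mulrA ler_wpM2l //.
exact: le_blin_norm.
Qed.

Definition adjoint_fun (f : dual F) : dual E :=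
  mk_blin (comp_linear f) (ex_intro _ _ (comp_le f)).

Lemma adjoint_linear : linear adjoint_fun.
Proof. by move=> a f g; apply: blin_ext. Qed.

Lemma adjoint_bounded : exists M, forall f, `|adjoint_fun f| <= M * `|f|.
Proof.
exists `|T| => f; rewrite mulrC; apply: opnorm_le; last exact: comp_le.
by rewrite mulr_ge0.
Qed.

Definition adjoint : blin (dual F) (dual E) :=
  mk_blin adjoint_linear adjoint_bounded.

End Adjoint.
End Duality.

HB.mixin Record isBanachAlgebra (K : numFieldType) A
    of CompleteNormedModule K A := {
  bmul : A -> A -> A;
  bmul_linear_l : forall b, linear (bmul^~ b);
  bmul_linear_r : forall a, linear (bmul a);
  bmulA : forall a b c, bmul a (bmul b c) = bmul (bmul a b) c;
  bmul_norm : forall a b, `|bmul a b| <= `|a| * `|b| }.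

(* No unit is assumed. *)
#[short(type="banachAlgType")]
HB.structure Definition BanachAlgebra (K : numFieldType) :=
  {A of CompleteNormedModule K A & isBanachAlgebra K A}.

(* The structure is unbundled from the carrier, so that two bimodules can share
   the same underlying Banach space. The actions are only required to be
   jointly bounded; [k] need not be 1. *)
Record bimodule (K : numFieldType) (A : banachAlgType K)
    (E : completeNormedModType K) := Bimodule {
  lact : A -> E -> E;
  ract : E -> A -> E;
  lact_linear_l : forall x, linear (lact^~ x);
  lact_linear_r : forall a, linear (lact a);
  ract_linear_l : forall a, linear (ract^~ a);
  ract_linear_r : forall x, linear (ract x);
  lactA : forall a b x, lact (bmul a b) x = lact a (lact b x);
  ractA : forall x a b, ract x (bmul a b) = ract (ract x a) b;
  lractA : forall a x b, ract (lact a x) b = lact a (ract x b);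
  act_bounded : exists k : K, forall a x,
    `|lact a x| <= k * `|a| * `|x| /\ `|ract x a| <= k * `|x| * `|a| }.

Section ArensProduct.
Context {K : scalarFieldType} {A : banachAlgType K}.

Section LeftMultiplication.
Variable a : A.

Lemma bmul_bounded : exists M, forall b : A, `|bmul a b| <= M * `|b|.
Proof. by exists `|a| => b; exact: bmul_norm. Qed.

Definition lmul : blin A A := mk_blin (bmul_linear_r a) bmul_bounded.

End LeftMultiplication.

(* <a'a, b> = <a', ab> *)
Definition dual_mul (a' : dual A) (a : A) : dual A := adjoint (lmul a) a'.

(* <a''a', a> = <a'', a'a> *)
Section BidualDual.
Variables (a'' : dual (dual A)) (a' : dual A).

Lemma bidual_dual_linear : linear (fun a => a'' (dual_mul a' a)).
Proof.
move=> c a b; rewrite -blinZD; congr (blin_fun a'' _).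
by apply: blin_ext => x /=; rewrite bmul_linear_l blinZD.
Qed.

Lemma bidual_dual_le a :
  `|a'' (dual_mul a' a)| <= `|a''| * `|a'| * `|a|.
Proof.
rewrite (le_trans (le_blin_norm _ _)) // -mulrA ler_wpM2l //.
apply: opnorm_le => [|x]; first by rewrite mulr_ge0.
rewrite (le_trans (le_blin_norm a' (bmul a x))) // -mulrA ler_wpM2l //.
exact: bmul_norm.
Qed.

Definition bidual_dual_mul : dual A :=
  mk_blin bidual_dual_linear (ex_intro _ _ bidual_dual_le).

End BidualDual.

(* <a''b'', a'> = <a'', b''a'> *)
Section FirstArens.
Variables a'' b'' : dual (dual A).

Lemma arens_linear : linear (fun a' : dual A => a'' (bidual_dual_mul b'' a')).
Proof.
move=> c f g; rewrite -blinZD; congr (blin_fun a'' _).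
apply: blin_ext => x.
apply: etrans (blinZD b'' c (dual_mul f x) (dual_mul g x)).
by congr (blin_fun b'' _); exact: blin_ext.
Qed.

Lemma arens_bounded :
  exists M, forall a' : dual A, `|a'' (bidual_dual_mul b'' a')| <= M * `|a'|.
Proof.
exists (`|a''| * `|b''|) => f.
rewrite (le_trans (le_blin_norm _ _)) // -mulrA ler_wpM2l //.
by apply: opnorm_le => [|x]; [rewrite mulr_ge0 | exact: bidual_dual_le].
Qed.

Definition arens : dual (dual A) := mk_blin arens_linear arens_bounded.

End FirstArens.

Definition right_identity (e'' : dual (dual A)) : Prop :=
  forall a'', arens a'' e'' = a''.

Definition left_identity (e'' : dual (dual A)) : Prop :=
  forall a'', arens e'' a'' = a''.

End ArensProduct.

Section Bimodules.
Context {K : scalarFieldType} {A : banachAlgType K}.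
Context {E : completeNormedModType K}.
Variable M : bimodule A E.

Definition factors_left : Prop :=
  [set ract M x a | x in [set: E] & a in [set: A]] = [set: E].

Definition factors_right : Prop :=
  [set lact M a x | a in [set: A] & x in [set: E]] = [set: E].

Definition derivations : set (blin A E) :=
  [set D | forall x y, D (bmul x y) = lact M x (D y) + ract M (D x) y].

Definition inner (D : blin A E) : Prop :=
  exists e, forall a, D a = lact M a e - ract M e a.

Section ActionOperators.
Variable a : A.

Lemma lact_bounded : exists k, forall x, `|lact M a x| <= k * `|x|.
Proof. by have [k hk] := act_bounded M; exists (k * `|a|) => x; case: (hk a x). Qed.

Lemma ract_bounded : exists k, forall x, `|ract M x a| <= k * `|x|.
Proof.
have [k hk] := act_bounded M; exists (k * `|a|) => x.
by rewrite mulrAC; case: (hk a x).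
Qed.

Definition lact_op : blin E E := mk_blin (lact_linear_r M a) lact_bounded.
Definition ract_op : blin E E := mk_blin (ract_linear_l M a) ract_bounded.

End ActionOperators.

(* On the dual, <a.f, x> = <f, x.a> and <f.a, x> = <f, a.x>. *)
Definition dual_lact (a : A) (f : dual E) : dual E := adjoint (ract_op a) f.
Definition dual_ract (f : dual E) (a : A) : dual E := adjoint (lact_op a) f.

(* On the bidual, <a.p, f> = <p, f.a> and <p.a, f> = <p, a.f>. *)
Definition bidual_lact (a : A) (p : dual (dual E)) : dual (dual E) :=
  adjoint (adjoint (lact_op a)) p.
Definition bidual_ract (p : dual (dual E)) (a : A) : dual (dual E) :=
  adjoint (adjoint (ract_op a)) p.

Lemma bidual_lactE a p f : bidual_lact a p f = p (dual_ract f a).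
Proof. by []. Qed.

Lemma bidual_ractE p a f : bidual_ract p a f = p (dual_lact a f).
Proof. by []. Qed.

(* L_c(a) = c.a and R_c(a) = a.c for c in the bidual: the subscript names the
   side on which c stands, so [Lmap] uses the right action of [a]. *)
Definition Lmap (c : dual (dual E)) : A -> dual (dual E) := bidual_ract c.
Definition Rmap (c : dual (dual E)) : A -> dual (dual E) := bidual_lact^~ c.

End Bimodules.

Definition super_amenable (K : scalarFieldType) (A : banachAlgType K) : Prop :=
  forall (E : completeNormedModType K) (M : bimodule A E) (D : blin A E),
    derivations M D -> inner M D.

(* Main.v *)
(* A super-amenable algebra [A] has a unit [u]: the identity map of [A] is a
   derivation into [A] with one of its two actions replaced by zero, and writing
   it as an inner derivation produces a one-sided unit. The image of [u] is then
   the only one-sided identity of [A^**], so that [D''(e'')] is the image of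
   [D u]. Let [C] be [B] with the left [resp. right] action replaced by zero;
   then [D a = D (u a) = D u . a] [resp. [D a = D (a u) = a . D u]] for every
   derivation [D], that is [D = L_{D''(e'')}] [resp. [R_{D''(e'')}]]. *)
Require Import Defs.
From mathcomp Require Import all_boot all_order all_algebra.
From mathcomp Require Import all_classical all_reals all_analysis.

Set Implicit Arguments.
Unset Strict Implicit.
Unset Printing Implicit Defensive.

Import Order.TTheory GRing.Theory Num.Theory.

Local Open Scope classical_set_scope.
Local Open Scope ring_scope.

Section TrivialActions.
Context {K : scalarFieldType} {A : banachAlgType K}.

Lemma zero_map_linear (U V : lmodType K) : linear (fun _ : U => 0 : V).
Proof. by move=> c x y; rewrite scaler0 addr0. Qed.

Section Bimodule.
Context {E : completeNormedModType K} (M : bimodule A E).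

(** If [A] or [E] is zero, the constant of [act_bounded] can be any scalar; a nonnegative one also
    bounds an action replaced by zero. *)
Lemma act_bounded_ge0 : exists2 k : K, 0 <= k & forall a x,
  `|lact M a x| <= k * `|a| * `|x| /\ `|ract M x a| <= k * `|x| * `|a|.
Proof.
have le_abs (k r s t : K) : 0 <= t -> 0 <= r -> 0 <= s ->
    t <= k * r * s -> t <= `|k| * r * s.
  move=> t0 r0 s0 h; have p0 := le_trans t0 h.
  by rewrite -(ger0_norm p0) !normrM (ger0_norm r0) (ger0_norm s0) in h.
have [k hk] := act_bounded M; exists `|k| => // a x.
by have [hl hr] := hk a x; split; apply: le_abs.
Qed.

(** Derivations into this bimodule are the bounded right module maps, [D (xy) = (D x) y]. The
    definition is transparent so that the zero action simplifies away. *)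
Definition zero_lact : bimodule A E.
Proof.
refine (@Bimodule K A E (fun _ _ => 0) (ract M) _ _ (ract_linear_l M)
  (ract_linear_r M) _ (ractA M) _ _).
- by move=> x; exact: zero_map_linear.
- by move=> a; exact: zero_map_linear.
- by [].
- by move=> a x b; exact: (blin0 (ract_op M b)).
- have [k k0 hk] := act_bounded_ge0; exists k => a x.
  by rewrite normr0 !mulr_ge0 //; split=> //; case: (hk a x).
Defined.

Definition zero_ract : bimodule A E.
Proof.
refine (@Bimodule K A E (lact M) (fun _ _ => 0) (lact_linear_l M)
  (lact_linear_r M) _ _ (lactA M) _ _ _).
- by move=> a; exact: zero_map_linear.
- by move=> x; exact: zero_map_linear.
- by [].
- by move=> a x b; exact: esym (blin0 (lact_op M a)).
- have [k k0 hk] := act_bounded_ge0; exists k => a x.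
  by rewrite normr0 !mulr_ge0 //; split=> //; case: (hk a x).
Defined.

End Bimodule.

Definition regular_bimodule : bimodule A A.
Proof.
refine (@Bimodule K A A bmul bmul bmul_linear_l bmul_linear_r bmul_linear_l
  bmul_linear_r _ bmulA _ _).
- by move=> a b x; rewrite bmulA.
- by move=> a x b; rewrite bmulA.
- by exists 1 => a x; rewrite !mul1r; split; exact: bmul_norm.
Defined.

Lemma id_blin_linear : linear (@id A).
Proof. by []. Qed.

Lemma id_blin_bounded : exists k : K, forall a : A, `|a| <= k * `|a|.
Proof. by exists 1 => a; rewrite mul1r. Qed.

Definition id_blin : blin A A := mk_blin id_blin_linear id_blin_bounded.

Lemma super_amenable_unital : super_amenable A ->
  exists u : A, (forall a, bmul a u = a) /\ (forall a, bmul u a = a).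
Proof.
move=> sA.
(* Innerness of the identity reads [a = a e - 0], so [e] is a right unit. *)
have [|e he] := sA _ (zero_ract regular_bimodule) id_blin.
  by move=> x y /=; rewrite addr0.
(* Here innerness reads [a = 0 - f a], so [- f] is a left unit. *)
have [|f hf] := sA _ (zero_lact regular_bimodule) id_blin.
  by move=> x y /=; rewrite add0r.
have ae a : bmul a e = a by have /= := he a; rewrite subr0.
have fa a : bmul (- f) a = a.
  have /= {2}-> := hf a.
  have := bmul_linear_l a (-1) f 0.
  have := blin0 (ract_op regular_bimodule a) => /= ->.
  by rewrite !addr0 !scaleN1r sub0r.
(* The one-sided units coincide: [e = (- f) e = - f]. *)
by exists e; split=> // a; have := fa e; rewrite ae => <-.
Qed.

End TrivialActions.

Section Bidual.
Context {K : scalarFieldType} {A : banachAlgType K} (u : A).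
Hypotheses (au : forall a, bmul a u = a) (ua : forall a, bmul u a = a).

(** The image of [u] fixes each functional [f] in the product [a'' a'], because [f (a u) = f a]. *)
Lemma unit_right_identity : right_identity (bidual_emb u).
Proof.
move=> a''; apply: blin_ext => f /=; congr (blin_fun a'' _).
by apply: blin_ext => a /=; rewrite au.
Qed.

Lemma unit_left_identity : left_identity (bidual_emb u).
Proof.
move=> a''; apply: blin_ext => f /=; congr (blin_fun a'' _).
by apply: blin_ext => a /=; rewrite ua.
Qed.

(** A right identity equals any left identity, and the image of [u] is one. *)
Lemma right_identity_unit e'' : right_identity e'' -> e'' = bidual_emb u.
Proof. by move=> /(_ (bidual_emb u)) <-; rewrite unit_left_identity. Qed.

Lemma left_identity_unit e'' : left_identity e'' -> e'' = bidual_emb u.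
Proof. by move=> /(_ (bidual_emb u)) <-; rewrite unit_right_identity. Qed.

Context {E : completeNormedModType K} (M : bimodule A E) (D : blin A E).

Lemma derivation_zero_lact : derivations (zero_lact M) D ->
  Lmap (zero_lact M) (adjoint (adjoint D) (bidual_emb u)) =
  (fun a => bidual_emb (D a)).
Proof.
move=> dD; apply: funext => a; apply: blin_ext => f /=.
(* Evaluated at [f], the left side is [f ((D u) a)], and [(D u) a = D (u a)]. *)
by have /= := dD u a; rewrite ua add0r => ->.
Qed.

Lemma derivation_zero_ract : derivations (zero_ract M) D ->
  Rmap (zero_ract M) (adjoint (adjoint D) (bidual_emb u)) =
  (fun a => bidual_emb (D a)).
Proof.
move=> dD; apply: funext => a; apply: blin_ext => f /=.
by have /= := dD a u; rewrite au addr0 => ->.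
Qed.

End Bidual.

Theorem mainTheorem10 (K : scalarFieldType) (A : banachAlgType K)
    (B : completeNormedModType K) (MB : bimodule A B) :
  super_amenable A ->
  (factors_left MB ->
    exists MC : bimodule A B,
      (exists e'' : dual (dual A), right_identity e'') /\
      forall e'' : dual (dual A), right_identity e'' ->
        [set (fun a : A => bidual_emb (D a)) | D in derivations MC] =
        [set Lmap MC (adjoint (adjoint D) e'') | D in derivations MC]) /\
  (factors_right MB ->
    exists MC : bimodule A B,
      (exists e'' : dual (dual A), left_identity e'') /\
      forall e'' : dual (dual A), left_identity e'' ->
        [set (fun a : A => bidual_emb (D a)) | D in derivations MC] =
        [set Rmap MC (adjoint (adjoint D) e'') | D in derivations MC]).
Proof.
move=> /super_amenable_unital[u [au ua]]; split=> _.
- exists (zero_lact MB); split.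
    by exists (bidual_emb u); exact: unit_right_identity.
  (* The sets agree term by term: each [D] is its own [L_{D''(e'')}]. *)
  move=> e'' /(right_identity_unit ua) ->; apply: eq_imagel => D dD.
  by rewrite derivation_zero_lact.
- exists (zero_ract MB); split.
    by exists (bidual_emb u); exact: unit_left_identity.
  move=> e'' /(left_identity_unit au) ->; apply: eq_imagel => D dD.
  by rewrite derivation_zero_ract.
Qed.
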